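(* Let $\mathcal{G}$ be a locally convex topological $\widetilde{\mathbb{C}}$-module which is a Baire space, and let $\mathcal{F}$ be a locally convex topological $\widetilde{\mathbb{C}}$-module which has a web of type $\mathcal{C}$. If a $\widetilde{\mathbb{C}}$-linear map $T:\mathcal{G}\to\mathcal{F}$ has closed graph (in $\mathcal{G}\times\mathcal{F}$ with the product topology), then $T$ is continuous.
   Context: Generalized numbers: $\widetilde{\mathbb{C}}=\mathcal{E}_M/\mathcal{N}$, where $\mathcal{E}_M$ is the ring of nets $(c_\varepsilon)_\varepsilon\in\mathbb{C}^{(0,1]}$ with $|c_\varepsilon|=O(\varepsilon^{-N})$ as $\varepsilon\to0$ for some $N\in\mathbb{N}$, and $\mathcal{N}$ is the ideal of nets with $|c_\varepsilon|=O(\varepsilon^{q})$ for all $q\in\mathbb{N}$; $[(c_\varepsilon)_\varepsilon]$ denotes the class of $(c_\varepsilon)_\varepsilon$. The valuation is $\mathrm{v}(c)=\sup\{b\in\mathbb{R}: |c_\varepsilon|=O(\varepsilon^b)\text{ as }\varepsilon\to0\}$ and $|c|_{\mathrm e}=e^{-\mathrm{v}(c)}$; $\widetilde{\mathbb{C}}$ carries the topology of the ultrametric $|c-d|_{\mathrm e}$. A topological $\widetilde{\mathbb{C}}$-module is a $\widetilde{\mathbb{C}}$-module with a topology making addition and scalar multiplication $\widetilde{\mathbb{C}}\times\mathcal{G}\to\mathcal{G}$ continuous. A subset $A$ of a $\widetilde{\mathbb{C}}$-module is convex if $A+A\subseteq A$ and $[(\varepsilon^b)_\varepsilon]A\subseteq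 A$ for all $b\ge0$. A topological $\widetilde{\mathbb{C}}$-module is locally convex if it has a base of convex neighborhoods of $0$. A web on a locally convex topological $\widetilde{\mathbb{C}}$-module $\mathcal{F}$ is a family $\mathcal{W}=\{C(n_1,\dots,n_k)\}$ of subsets of $\mathcal{F}$, with $k,n_1,\dots,n_k$ running through $\mathbb{N}\setminus0$, such that $\mathcal{F}=\bigcup_{n_1\ge1}C(n_1)$ and $C(n_1,\dots,n_{k-1})=\bigcup_{n_k\ge1}C(n_1,\dots,n_k)$ for all $k>1$ and all $n_1,\dots,n_{k-1}$. It is of type $\mathcal{C}$ if for every sequence $(n_k)_{k\ge1}$ in $\mathbb{N}\setminus0$ there is a sequence $(\rho_k)_{k\ge1}$ in $\mathbb{R}$ such that for all $\lambda_k\ge\rho_k$ and all $x_k\in C(n_1,\dots,n_k)$ ($k\ge1$) the series $\sum_{k=1}^\infty[(\varepsilon^{\lambda_k})_\varepsilon]x_k$ converges in $\mathcal{F}$. *)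

(* Defs.v *)
From HB Require Import structures.
From mathcomp Require Import all_boot all_order all_algebra.
From mathcomp Require Import generic_quotient ring_quotient complex.
From mathcomp Require Import all_classical all_reals all_analysis.

Set Implicit Arguments.
Unset Strict Implicit.
Unset Printing Implicit Defensive.

Import Order.TTheory GRing.Theory Num.Theory.
Import ComplexField.Normc.

Local Open Scope classical_set_scope.
Local Open Scope ring_scope.

Section GeneralizedNumbers.
Variable R : realType.

Definition I01 : Type := {e : R | 0 < e <= 1}.

Lemma I01_one_subproof : 0 < (1 : R) <= 1.
Proof. by rewrite ltr01 lexx. Qed.

HB.instance Definition _ := Choice.on I01.
HB.instance Definition _ := isPointed.Build I01 (exist _ 1 I01_one_subproof).

Definition net : Type := I01 -> R[i].
HB.instance Definition _ := GRing.ComNzRing.on net.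

(* |c_e| = O(e ^ b) as e -> 0 *)
Definition bigO_pow (c : net) (b : R) : Prop :=
  exists K eta : R, 0 < eta /\
    forall e : I01, val e < eta -> normc (c e) <= K * val e `^ b.

Lemma bigO_pow_mono (c : net) (a b : R) :
  a <= b -> bigO_pow c b -> bigO_pow c a.
Proof.
move=> ab [K [eta [eta0 H]]]; exists `|K|, eta; split=> // e /H /le_trans; apply.
have /andP[e0 e1] := valP e.
rewrite (@le_trans _ _ (`|K| * val e `^ b))//.
  by rewrite ler_wpM2r ?powR_ge0 ?ler_norm.
by rewrite ler_wpM2l// ger_powR// e0.
Qed.

Lemma bigO_pow0 (b : R) : bigO_pow 0 b.
Proof.
by exists 0, 1; split=> // e _; rewrite (_ : (0 : net) e = 0)// normc0 mul0r.
Qed.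

Lemma bigO_pow1 : bigO_pow 1 0.
Proof.
exists 1, 1; split=> // e _.
by rewrite (_ : (1 : net) e = 1)// normc1 powRr0 mulr1.
Qed.

Lemma bigO_powN (c : net) (b : R) : bigO_pow c b -> bigO_pow (- c) b.
Proof.
move=> [K [eta [eta0 H]]]; exists K, eta; split=> // e /H.
by rewrite (_ : (- c) e = - c e)// normcN.
Qed.

Lemma bigO_powD (c d : net) (b : R) :
  bigO_pow c b -> bigO_pow d b -> bigO_pow (c + d) b.
Proof.
move=> [K [k [k0 Hc]]] [L [l [l0 Hd]]].
exists (K + L), (Num.min k l); split; first by rewrite lt_min k0.
move=> e; rewrite lt_min => /andP[/Hc ec /Hd ed].
by rewrite (le_trans (le_normcD _ _))// mulrDl lerD.
Qed.

Lemma bigO_powM (c d : net) (a b : R) :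
  bigO_pow c a -> bigO_pow d b -> bigO_pow (c * d) (a + b).
Proof.
move=> [K [k [k0 Hc]]] [L [l [l0 Hd]]].
exists (K * L), (Num.min k l); split; first by rewrite lt_min k0.
move=> e; rewrite lt_min => /andP[/Hc ec /Hd ed].
have /andP[e0 _] := valP e.
have normc_ge0 (z : R[i]) : 0 <= normc z by case: z => x y; exact: sqrtr_ge0.
rewrite powRD; last by rewrite (gt_eqF e0) implybT.
by rewrite (_ : (c * d) e = c e * d e)// normcM mulrACA ler_pM.
Qed.

Definition moderate : {pred net} :=
  fun c => `[< exists N : nat, bigO_pow c (- N%:R) >].

Lemma moderate_subring : subring_closed moderate.
Proof.
split; first by apply/asboolP; exists 0%N; rewrite oppr0; exact: bigO_pow1.
- move=> c d /asboolP[N cN] /asboolP[M dM]; apply/asboolP; exists (N + M)%N.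
  apply: bigO_powD; first by apply: bigO_pow_mono cN; rewrite lerN2 ler_nat leq_addr.
  by apply/bigO_powN/(bigO_pow_mono _ dM); rewrite lerN2 ler_nat leq_addl.
- move=> c d /asboolP[N cN] /asboolP[M dM]; apply/asboolP; exists (N + M)%N.
  by rewrite natrD opprD; exact: bigO_powM.
Qed.

HB.instance Definition _ := GRing.isSubringClosed.Build net moderate moderate_subring.

Definition EM : Type := {c : net | moderate c}.
HB.instance Definition _ := SubChoice.on EM.
HB.instance Definition _ := [SubChoice_isSubComNzRing of EM by <:].

Definition negligible : {pred EM} :=
  fun c => `[< forall q : nat, bigO_pow (val c) q%:R >].

Lemma negligible_ideal : idealr_closed negligible.
Proof.
split.
- by apply/asboolP => q; rewrite raddf0; exact: bigO_pow0.
- apply/negP => /asboolP /(_ 1%N) [K [eta [eta0 H]]].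
  pose x : R := Num.min 1 (Num.min (eta / 2) (2 * (`|K| + 1))^-1).
  have K0 : 0 < 2 * (`|K| + 1) by rewrite mulr_gt0// ltr_wpDl.
  have x0 : 0 < x by rewrite !lt_min ltr01 divr_gt0//= invr_gt0.
  have x1 : x <= 1 by rewrite ge_min lexx.
  have xI : 0 < x <= 1 by rewrite x0.
  have xeta : x < eta.
    by rewrite !gt_min ltr_pdivrMr// ltr_pMr// ltr1n orbT.
  have := H (exist _ x xI) xeta; rewrite rmorph1.
  rewrite (_ : (1 : net) _ = 1)// normc1 /= powRr1 ?(ltW x0)// leNgt => /negP; apply.
  have xK : x * (2 * (`|K| + 1)) <= 1.
    by rewrite -ler_pdivlMr// mul1r !ge_min lexx !orbT.
  have Kx : K * x <= `|K| * x by rewrite ler_wpM2r ?ler_norm// ltW.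
  apply: (le_lt_trans Kx); apply: lt_le_trans xK.
  rewrite mulrCA mulrDr mulr1 (mulrC x) mulr_natl mulr2n.
  by rewrite -[ltLHS]addr0 ler_ltD ?lerDl ?(ltW x0)// ltr_wpDl// mulr_ge0// ltW.
- move=> a u v /asboolP Hu /asboolP Hv; apply/asboolP => q.
  rewrite rmorphD rmorphM /=; apply: bigO_powD => //.
  have /asboolP[N aN] := valP a.
  rewrite (_ : q%:R = - N%:R + (N + q)%:R :> R); last by rewrite natrD addKr.
  exact: bigO_powM.
Qed.

HB.instance Definition _ := isIdealr.Build EM negligible negligible_ideal.

Definition Ctilde : Type := {ideal_quot negligible}.
HB.instance Definition _ := GRing.ComNzRing.on Ctilde.
HB.instance Definition _ := EqQuotient.on Ctilde.

Definition class_of (c : EM) : Ctilde := \pi_Ctilde%qT c.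

Lemma repr_classK (c : Ctilde) : class_of (repr c) = c.
Proof. exact: reprK. Qed.

Lemma class_of_eq (c d : EM) :
  class_of c = class_of d <-> negligible (c - d).
Proof.
rewrite -[negligible _]/(c - d \in negligible) Quotient.idealrBE.
by split=> /eqP.
Qed.

Definition net_val (c : net) : \bar R :=
  ereal_sup [set b%:E | b in [set b : R | bigO_pow c b]].

(* Any representative gives the same value: see [valuation_class_of]. *)
Definition valuation (c : Ctilde) : \bar R := net_val (val (repr c)).

Definition enorm (c : Ctilde) : R := fine (expeR (- valuation c)%E).

Lemma net_val_ge (c : net) (b : R) : bigO_pow c b -> (b%:E <= net_val c)%E.
Proof. by move=> cb; apply: ereal_sup_ubound; exists b. Qed.

Lemma net_val_lt (c : net) (b : R) : (b%:E < net_val c)%E -> bigO_pow c b.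
Proof.
move=> /ereal_sup_gt[_ [a ca <-]]; rewrite lte_fin => /ltW ba.
exact: bigO_pow_mono ca.
Qed.

Lemma net_val_negligible (c : EM) :
  net_val (val c) = +oo%E <-> negligible c.
Proof.
split=> [cy|/asboolP cN].
  by apply/asboolP => q; apply: net_val_lt; rewrite cy ltry.
apply/eqyP => A A0; apply: net_val_ge.
apply: bigO_pow_mono (cN (Num.truncn A).+1).
by rewrite ltW// truncnS_gt.
Qed.

Lemma net_valN (c : net) : net_val (- c) = net_val c.
Proof.
congr ereal_sup; congr image; apply/seteqP; split=> b; last exact: bigO_powN.
by move=> /bigO_powN; rewrite opprK.
Qed.

Lemma net_valD (c d : net) :
  (Order.min (net_val c) (net_val d) <= net_val (c + d)%R)%E.
Proof.
have H (b : R) : (b%:E < Order.min (net_val c) (net_val d))%E ->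
    (b%:E <= net_val (c + d)%R)%E.
  by rewrite lt_min => /andP[/net_val_lt cb /net_val_lt db];
    exact/net_val_ge/bigO_powD.
case: (Order.min _ _) H => [r| |] H; last by rewrite leNye.
- apply/lee_subgt0Pr => e e0; rewrite -EFinB; apply: H.
  by rewrite lte_fin ltrBlDr ltrDl.
- by rewrite leye_eq; apply/eqP/eqyP => A _; exact/H/ltry.
Qed.

Lemma net_val_moderate (c : EM) : (-oo < net_val (val c))%E.
Proof.
have /asboolP[N cN] := valP c.
exact: lt_le_trans (ltNyr _) (net_val_ge cN).
Qed.

Lemma valuation_class_of (c : EM) : valuation (class_of c) = net_val (val c).
Proof.
rewrite /valuation.
have H (a b : EM) : class_of a = class_of b ->
    (net_val (val a) <= net_val (val b))%E.
  move=> /class_of_eq /net_val_negligible; rewrite rmorphB/= => ab.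
  rewrite -[leRHS]net_valN (_ : - val b = (val a - val b) - val a); last first.
    by rewrite addrAC subrr sub0r.
  apply: le_trans (net_valD _ _).
  by rewrite ab net_valN le_min leey lexx.
have e := repr_classK (class_of c).
by apply/eqP; rewrite eq_le !H.
Qed.

Lemma enorm_eq0 (c : Ctilde) : enorm c = 0 -> c = 0.
Proof.
rewrite -[c]repr_classK /enorm valuation_class_of.
have := net_val_moderate (repr c); have := net_val_negligible (repr c).
case: (net_val _) => [r| |] // [h _] _ => [/eqP|_]; first by rewrite expR_eq0.
rewrite (_ : 0 = class_of 0); last by rewrite /class_of piE.
by apply/class_of_eq; rewrite subr0; exact: h.
Qed.

Lemma enorm0 : enorm 0 = 0.
Proof.
rewrite /enorm (_ : 0 = class_of 0); last by rewrite /class_of piE.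
rewrite valuation_class_of (_ : net_val _ = +oo%E)//.
by apply/net_val_negligible/asboolP => q; exact: bigO_pow0.
Qed.

Lemma enormN (c : Ctilde) : enorm (- c) = enorm c.
Proof.
rewrite -[c]repr_classK.
rewrite (_ : - class_of _ = class_of (- repr c)); last by rewrite /class_of piE.
by rewrite /enorm !valuation_class_of rmorphN net_valN.
Qed.

Lemma enorm_ge0 (c : Ctilde) : 0 <= enorm c.
Proof. by rewrite fine_ge0// expeR_ge0. Qed.

Lemma enormD (c d : Ctilde) : enorm (c + d) <= Num.max (enorm c) (enorm d).
Proof.
rewrite -[c]repr_classK -[d]repr_classK.
rewrite (_ : class_of _ + _ = class_of (repr c + repr d)); last first.
  by rewrite /class_of piE.
rewrite /enorm !valuation_class_of rmorphD/=.
have := net_valD (val (repr c)) (val (repr d)).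
have := net_val_moderate (repr c + repr d); rewrite rmorphD/=.
have := net_val_moderate (repr c); have := net_val_moderate (repr d).
have fine_expeR (x y : \bar R) : (-oo < x)%E -> (x <= y)%E ->
    fine (expeR (- y)%E) <= fine (expeR (- x)%E).
  by case: x y => [x| |] [y| |] //= _; rewrite lee_fin ler_expR lerN2.
move=> d0 c0 s0; rewrite ge_min => /orP[] h; rewrite le_max.
  by apply/orP; left; exact: fine_expeR.
by apply/orP; right; exact: fine_expeR.
Qed.

Definition edist (c d : Ctilde) : R := enorm (c - d).

Lemma edistxx (c : Ctilde) : edist c c = 0.
Proof. by rewrite /edist subrr enorm0. Qed.

Lemma edist_eq0 (c d : Ctilde) : edist c d = 0 -> c = d.
Proof. by move=> /enorm_eq0 /subr0_eq. Qed.

Lemma edistC (c d : Ctilde) : edist c d = edist d c.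
Proof. by rewrite /edist -enormN opprB. Qed.

Lemma edist_triangle (d c e : Ctilde) : edist c e <= edist c d + edist d e.
Proof.
rewrite /edist -(subrKA d c).
by rewrite (le_trans (enormD _ _))// ge_max lerDl lerDr !enorm_ge0.
Qed.

HB.instance Definition _ := isMetric.Build R Ctilde
  edistxx edist_eq0 edistC edist_triangle.

Definition eps_net (b : R) : net := fun e => ((val e `^ b)%:C)%C.

Lemma eps_net_moderate (b : R) : moderate (eps_net b).
Proof.
apply/asboolP; exists (Num.truncn `|b|).+1.
apply: (@bigO_pow_mono _ _ b); last first.
  exists 1, 1; split=> // e _; rewrite /eps_net /= expr0n addr0 sqrtr_sqr.
  by rewrite ger0_norm ?powR_ge0// mul1r.
rewrite lerNl (le_trans (ler_norm _))// normrN ltW//.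
by rewrite truncnS_gt.
Qed.

(* the class [(e ^ b)_e] *)
Definition eps_pow (b : R) : Ctilde :=
  class_of (exist _ (eps_net b) (eps_net_moderate b)).

End GeneralizedNumbers.

(* A module over Ctilde with a topology making addition and scalar
   multiplication continuous. The library's TopologicalLmodule is not
   available as its scalars form a numDomainType. *)
Record topGModType (R : realType) := TopGModType {
  topGMod_base : PreTopologicalZmodule.type;
  topGMod_lmod : GRing.Zmodule_isLmodule (Ctilde R) topGMod_base;
  topGMod_add_continuous :
    continuous (fun x : topGMod_base * topGMod_base => x.1 + x.2);
  topGMod_scale_continuous :
    continuous (fun z : Ctilde R * topGMod_base =>
      GRing.Zmodule_isLmodule.scale topGMod_lmod z.1 z.2)
}.

Definition topGMod_sort (R : realType) (M : topGModType R) : Type :=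
  topGMod_base M.
Coercion topGMod_sort : topGModType >-> Sortclass.

HB.instance Definition _ (R : realType) (M : topGModType R) :=
  PreTopologicalZmodule.on (topGMod_sort M).
HB.instance Definition _ (R : realType) (M : topGModType R) :
  GRing.Zmodule_isLmodule (Ctilde R) (topGMod_sort M) := topGMod_lmod M.

Lemma gscale_continuous (R : realType) (M : topGModType R) :
  continuous (fun z : Ctilde R * M => z.1 *: z.2).
Proof. exact: topGMod_scale_continuous. Qed.

Lemma gopp_continuous (R : realType) (M : topGModType R) :
  continuous (-%R : M -> M).
Proof.
pose f (x : M) : Ctilde R * M := (-1, x).
pose g (z : Ctilde R * M) : M := z.1 *: z.2.
rewrite (_ : -%R = g \o f); last first.
  by apply/funext => x; rewrite /f /g /= scaleN1r.
move=> x; apply: (@continuous_comp _ _ _ f g); last exact: gscale_continuous.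
apply: (@cvg_pair _ _ _ (nbhs x) (nbhs (-1 : Ctilde R)) (nbhs x)).
  exact: cvg_cst.
exact: cvg_id.
Qed.

HB.instance Definition _ (R : realType) (M : topGModType R) :=
  PreTopologicalNmodule_isTopologicalNmodule.Build (topGMod_sort M)
    (@topGMod_add_continuous R M).
HB.instance Definition _ (R : realType) (M : topGModType R) :=
  TopologicalNmodule_isTopologicalZmodule.Build (topGMod_sort M)
    (@gopp_continuous R M).

Definition gconvex (R : realType) (M : lmodType (Ctilde R)) (A : set M) : Prop :=
  (forall x y, A x -> A y -> A (x + y)) /\
  (forall b : R, 0 <= b -> forall x, A x -> A (eps_pow b *: x)).

Definition locally_gconvex (R : realType) (M : topGModType R) : Prop :=
  forall U : set M, nbhs 0 U ->
    exists V : set M, [/\ nbhs 0 V, gconvex V & V `<=` U].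

Definition baire_space (T : topologicalType) : Prop :=
  forall F : (set T)^nat,
    (forall i, open (F i) /\ dense (F i)) -> dense (\bigcap_i F i).

(* The set C(n_1, ..., n_k) is C [:: n_1; ...; n_k]; the values of C at the
   empty list and at lists containing 0 play no role. *)
Definition is_web (T : Type) (C : seq nat -> set T) : Prop :=
  [set: T] = \bigcup_(n in [set n | (0 < n)%N]) C [:: n] /\
  forall s : seq nat, s != [::] -> all (fun n => 0 < n)%N s ->
    C s = \bigcup_(n in [set n | (0 < n)%N]) C (rcons s n).

(* Sequences indexed by k >= 1 are shifted to start at 0, so that
   mkseq n k.+1 is the list n_1, ..., n_(k+1). *)
Definition web_of_type_C (R : realType) (M : topGModType R)
    (C : seq nat -> set M) : Prop :=
  forall n : nat -> nat, (forall k, (0 < n k)%N) ->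
    exists rho : nat -> R, forall (lambda : nat -> R) (x : nat -> M),
      (forall k, rho k <= lambda k) ->
      (forall k, C (mkseq n k.+1) (x k)) ->
      exists l : M, series (fun k => eps_pow (lambda k) *: x k) @ \oo --> l.

Definition has_web_of_type_C (R : realType) (M : topGModType R) : Prop :=
  exists C : seq nat -> set M, is_web C /\ web_of_type_C C.

(* Main.v *)
Require Import Defs.
From mathcomp Require Import all_boot all_order all_algebra.
From mathcomp Require Import complex.
From mathcomp Require Import all_classical all_reals all_analysis.

Import Order.TTheory GRing.Theory Num.Theory.

Local Open Scope classical_set_scope.
Local Open Scope ring_scope.

(** The proof is a gliding hump along one branch of the web, with category
    used to find the branch.

    Reduce continuity to showing that the preimage of V is a neighborhood of 0,
    for V in a base of neighborhoods of 0 in F.  A convex neighborhood met with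
    its opposite is still convex, and is then an additive subgroup
    ([gconvex_subgroup]); so V may be taken to be a closed subgroup stable
    under the scalars eps^b, b >= 0.

    As G is not meager, there is a sequence n along which all the sets
    T^-1 (C(n_1, ..., n_k)) are nonmeager ([web_nonmeager_branch]).  Since V is
    absorbing, each of them has a nonmeager part D_k that some eps^(m_k) sends
    into T^-1 V.  Put B_k = eps^(lambda_k) D_k, where lambda_k is at least both
    m_k and the exponent rho_k that the web attaches to n.  Then T maps B_k into
    V, every series of images T b_k with b_k in B_k converges, and B_k is dense
    in a neighborhood of one of its points y_k.

    These three properties suffice ([closed_graph_thick]).  From an x
    close to 0 subtract successively the b_k - y_k, where b_k in B_k is chosen
    so that the residual lies in the neighborhood of 0 belonging to B_(k+1).  The
    images of the partial sums lie in V and converge to some w in the closed set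
    V, so T x = w would finish.  The space G need not be metrizable, and the
    residuals need not tend to 0; instead, the density of B_k near y_k lets one
    more term c_k - y_k with c_k in B_k correct the k-th residual up to any
    prescribed neighborhood of 0.  The images of these corrections tend to 0, as
    terms of convergent series, so (x, w) adheres to the graph, which is
    closed. *)

(** * Meager sets and Baire spaces *)

(** Membership in a meager set is expressed with the complements, open and
    dense, of closed nowhere dense sets, to match the definition of a Baire
    space. *)
Definition meager {X : topologicalType} (A : set X) : Prop :=
  exists2 O : (set X)^nat,
    (forall i, open (O i) /\ dense (O i)) & A `&` \bigcap_i O i = set0.

Lemma meager_bigcup (X : topologicalType) (A : (set X)^nat) :
  (forall n, meager (A n)) -> meager (\bigcup_n A n).
Proof.
move=> mA; have /choice[U UP] : forall n, exists U : (set X)^nat,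
    (forall i, open (U i) /\ dense (U i)) /\ A n `&` \bigcap_i U i = set0.
  by move=> n; have [V ? ?] := mA n; exists V.
(* Enumerate the pairs (n, j); indices that code no pair contribute setT. *)
exists (fun i => if unpickle i is Some (n, j) then U n j else setT).
  move=> i; case: (unpickle i) => [[n j]|]; first exact: (UP n).1.
  by split; [exact: openT | move=> V V0 _; rewrite setIT].
apply/seteqP; split=> // x [[n _ Anx] Ux].
rewrite -(UP n).2; split=> // j _.
by have := Ux (pickle (n, j)) I; rewrite pickleK.
Qed.

Lemma nonmeager_pieces (X : topologicalType) (A : set X) (B : (set X)^nat) :
  ~ meager A -> A `<=` \bigcup_n B n -> exists n, ~ meager (A `&` B n).
Proof.
move=> nmA AB; apply/not_existsP => mAB; apply: nmA.
have -> : A = \bigcup_n (A `&` B n) by rewrite -setI_bigcupr; exact/esym/setIidPl.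
by apply: meager_bigcup => n; apply: contrapT => /mAB.
Qed.

Lemma baire_nonmeager (X : topologicalType) (x : X) :
  baire_space X -> ~ meager [set: X].
Proof.
move=> bX [U UP]; rewrite setTI => U0.
have := bX U UP setT; rewrite U0 setI0 => h.
by have [] : (@set0 X) !=set0 by apply: h; [exists x | exact: openT].
Qed.

(** The base point is required to lie in A itself because the gliding hump
    subtracts it from other points of A, and its image has to be controlled
    too. *)
Definition thick {X : topologicalType} (A : set X) : Prop :=
  (A `&` (closure A)°) !=set0.

(** If the closure of A had empty interior, A would be nowhere dense, hence
    meager.  The interior of the closure, once nonempty, must meet A. *)
Lemma nonmeager_thick (X : topologicalType) (A : set X) :
  ~ meager A -> thick A.
Proof.
move=> nmA; have [z zA] : (closure A)° !=set0.
  apply/set0P/eqP => A0; apply: nmA; exists (fun=> ~` closure A).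
    move=> _; split; first exact/closed_openC/closed_closure.
    move=> U [u Uu] oU; apply: contrapT => UA.
    suff : (closure A)° u by rewrite A0.
    apply: filterS (open_nbhs_nbhs (conj oU Uu)) => v Uv.
    by apply: contrapT => Av; apply: UA; exists v.
  apply/seteqP; split=> // x [Ax /(_ 0%N I)]; apply; exact: subset_closure.
have := interior_subset zA; apply.
exact/open_nbhs_nbhs/(conj (open_interior _)).
Qed.

Lemma thick_image (X Y : topologicalType) (f : X -> Y) (g : Y -> X)
    (A : set X) :
  continuous f -> continuous g -> cancel f g -> cancel g f ->
  thick A -> thick (f @` A).
Proof.
move=> cf cg fK gK [x [Ax xA]]; exists (f x); split; first by exists x.
have : nbhs (f x) (g @^-1` closure A) by apply: cg; rewrite fK.
apply: filterS => y Ay W /= Wy.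
have /Ay[a [Aa Wa]] : nbhs (g y) (f @^-1` W) by apply: cf; rewrite gK.
by exists (f a); split=> //; exists a.
Qed.

(** * Closed graphs over topological groups *)

Section TopologicalGroup.
Variable M : topologicalZmodType.

Lemma cvgD_group (I : Type) (H : set_system I) {HF : Filter H} (f g : I -> M)
    (a b : M) :
  f @ H --> a -> g @ H --> b -> (fun i => f i + g i) @ H --> a + b.
Proof.
exact: (@continuous2_cvg _ _ _ _ _ _ _ _ +%R _ _ (@add_continuous M (a, b))).
Qed.

Lemma cvgB_group (I : Type) (H : set_system I) {HF : Filter H} (f g : I -> M)
    (a b : M) :
  f @ H --> a -> g @ H --> b -> (fun i => f i - g i) @ H --> a - b.
Proof.
pose sub (x y : M) := x - y.
exact: (@continuous2_cvg _ _ _ _ _ _ _ _ sub _ _ (@sub_continuous M (a, b))).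
Qed.

Lemma series_term_cvg0 (u : nat -> M) (l : M) :
  series u @ \oo --> l -> u @ \oo --> 0.
Proof.
move=> ul; rewrite -(subrr l).
have -> : u = (fun n => series u n.+1 - series u n).
  by apply/funext => n; rewrite seriesSB.
apply: cvgB_group => //; have := cvg_comp _ _ (cvg_addnr 1) ul.
by under eq_fun do rewrite /= addn1.
Qed.

(** The complement of a subgroup is a union of cosets, which are open. *)
Lemma subgroup_closed (V : set M) :
  nbhs 0 V -> (forall x y, V x -> V y -> V (x - y)) -> closed V.
Proof.
move=> V0 VB x clx.
have : nbhs x [set z | V (x - z)].
  have := @cvgB_group _ (nbhs x) _ (fun=> x) id x x (cvg_cst _) (@cvg_id _ _).
  by rewrite subrr; exact.
move=> /clx[z [Vz /= Vxz]].
have V00 : V 0 by exact: nbhs_singleton.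
have VNz : V (- z) by rewrite -sub0r; exact: VB.
by have := VB _ _ Vxz VNz; rewrite opprK subrK.
Qed.

End TopologicalGroup.

(** The gliding hump.  There are countably many sets B k, while the
    neighborhoods of 0 in G may have no countable base: the residuals of x need
    not tend to 0, and the closed graph is applied to partial sums of
    corrections with one extra term. *)
Lemma closed_graph_thick (G F : topologicalZmodType) (T : {additive G -> F})
    (V : set F) (B : (set G)^nat) :
  closed [set p : G * F | p.2 = T p.1] ->
  closed V -> (forall x y, V x -> V y -> V (x + y)) ->
  (forall x y, V x -> V y -> V (x - y)) ->
  (forall k, thick (B k)) -> (forall k b, B k b -> V (T b)) ->
  (forall b : nat -> G, (forall k, B k (b k)) ->
    exists l : F, series (T \o b) @ \oo --> l) ->
  nbhs (0 : G) (T @^-1` V).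
Proof.
move=> graphT clV VD VB thB BV serB.
have /choice[y yP] := thB.
have By k : B k (y k) := (yP k).1.
(* Residuals in W k can be approximated by differences b - y k, b in B k. *)
pose W k : set G := [set w | closure (B k) (y k + w)].
have W0 k : nbhs 0 (W k).
  have : (fun w => y k + w) @ (0 : G) --> y k + 0.
    by apply: cvgD_group; [exact: cvg_cst | exact: cvg_id].
  by apply; rewrite addr0; exact: (yP k).2.
have sub_nbhs (z : G) (U : set G) : nbhs 0 U -> nbhs z [set b | U (z - b)].
  move=> U0; have := @cvgB_group _ _ (nbhs z) _ (fun=> z) id z z (cvg_cst _) (@cvg_id _ _).
  by rewrite subrr; exact.
have step k (U : set G) : nbhs 0 U ->
    forall r, exists b, W k r -> B k b /\ U (r + y k - b).
  move=> U0 r; have [Wr|nW] := pselect (W k r); last by exists 0 => /nW.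
  have [b [Bb Ub]] := Wr _ (sub_nbhs _ _ U0).
  by exists b => _; rewrite (addrC r).
have /choice[f fP] : forall kr : nat * G, exists b, W kr.1 kr.2 ->
    B kr.1 b /\ W kr.1.+1 (kr.2 + y kr.1 - b).
  by move=> [k r]; exact: step.
apply: filterS (W0 0%N) => x W0x.
(* r k is what remains of x after k corrections b j - y j. *)
pose r := fix r k := if k is j.+1 then r j + y j - f (j, r j) else x.
have Wr k : W k (r k).
  by elim: k => // k IH; exact: (fP (k, r k) IH).2.
pose b k := f (k, r k).
have Bb k : B k (b k) by exact: (fP (k, r k) (Wr k)).1.
have xr k : x - r k = series b k - series y k.
  elim: k => [|k IH]; first by rewrite /series /= !big_geq// !subrr.
  rewrite !seriesSr [- (series y k + _)]opprD addrACA -IH.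
  by rewrite -[r k.+1]/(r k + y k - b k) -[r k + _ - _]addrA opprD opprB !addrA.
have [lb lbP] := serB b Bb; have [ly lyP] := serB y By.
have Tser (u : nat -> G) k : T (series u k) = series (T \o u) k.
  by rewrite /series /= raddf_sum.
have Txr : (fun k => T (x - r k)) @ \oo --> lb - ly.
  have -> : (fun k => T (x - r k)) =
      (fun k => series (T \o b) k - series (T \o y) k).
    by apply/funext => k; rewrite xr raddfB /= !Tser.
  exact: cvgB_group.
have V0 : V 0 by rewrite -(subrr (T (y 0%N))); apply: VB; exact: BV (By _).
have serV (u : nat -> G) k : (forall k, B k (u k)) -> V (series (T \o u) k).
  move=> Bu; elim: k => [|k IH]; first by rewrite /series /= big_geq.
  by rewrite seriesSr; apply: VD => //; exact: BV (Bu _).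
have Vlim : V (lb - ly).
  apply: (closed_cvg V clV _ _ Txr); apply: nearW => k.
  by rewrite xr raddfB /= !Tser; apply: VB; exact: serV.
suff Tx : T x = lb - ly by rewrite /= Tx.
apply/esym/(graphT (x, lb - ly)) => N [[P Q] /= [Px Qw] PQ].
(* For this P, end the k-th partial sum with c k in B k instead of b k, chosen
   so that the sum falls in P; the choices c k depend on P. *)
have P0 : nbhs 0 [set z | P (x - z)].
  have := @cvgB_group _ _ (nbhs (0 : G)) _ (fun=> x) id x 0 (cvg_cst _) (@cvg_id _ _).
  by rewrite subr0; apply.
have /choice[c cP] : forall k, exists c, B k c /\ P (x - (r k + y k - c)).
  by move=> k; have [c cP] := step k _ P0 (r k); exists c; exact: cP (Wr k).
have [lc lcP] := serB c (fun k => (cP k).1).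
have Tu : (fun k => T (x - (r k + y k - c k))) @ \oo --> lb - ly.
  have -> : (fun k => T (x - (r k + y k - c k))) =
      (fun k => T (x - r k) + ((T \o c) k - (T \o y) k)).
    apply/funext => k /=; rewrite -!raddfB -raddfD; congr (T _).
    by rewrite -[r k + _ - _]addrA opprD addrA opprB.
  rewrite -[lb - ly]addr0 -[X in _ --> _ + X](subrr 0).
  by apply: cvgD_group => //; apply: cvgB_group;
    [exact: series_term_cvg0 lcP | exact: series_term_cvg0 lyP].
have /filter_ex[k /= Qk] :
  \forall k \near \oo, Q (T (x - (r k + y k - c k))) by exact: Tu.
exists (x - (r k + y k - c k), T (x - (r k + y k - c k))); split=> //.
by apply: PQ; split=> //; exact: (cP k).2.
Qed.

(** * Generalized numbers and modules *)

Section EpsPow.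
Variable R : realType.

Lemma eps_pow0 : eps_pow (0 : R) = 1.
Proof.
rewrite (_ : 1 = class_of 1); last by rewrite /class_of piE.
congr class_of; apply/val_inj/funext => e /=.
by rewrite /eps_net powRr0.
Qed.

Lemma eps_powD (a b : R) : eps_pow (a + b) = eps_pow a * eps_pow b.
Proof.
pose net c : Defs.EM R := exist (fun u => moderate u) _ (eps_net_moderate c).
have -> : eps_pow a * eps_pow b = class_of (net a * net b).
  by rewrite /eps_pow /class_of piE.
congr class_of; apply/val_inj/funext => e /=.
have /andP[e0 _] := valP e.
rewrite /eps_net powRD; last by rewrite (gt_eqF e0) implybT.
exact: rmorphM.
Qed.

Lemma enorm_eps_pow (b : R) : enorm (eps_pow b) <= expR (- b).
Proof.
rewrite /enorm /eps_pow valuation_class_of /=.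
have : (b%:E <= net_val (eps_net b))%E.
  apply: net_val_ge; exists 1, 1; split=> // e _.
  rewrite /eps_net /= expr0n addr0 sqrtr_sqr mul1r.
  by rewrite ger0_norm ?powR_ge0.
case: (net_val _) => [r|_|//] /=; last exact: expR_ge0.
by rewrite lee_fin ler_expR lerN2.
Qed.

Lemma eps_pow_cvg0 : (fun n => eps_pow (n%:R : R)) @ \oo --> (0 : Ctilde R).
Proof.
move=> U /nbhs_ballP[d /= d0 dU].
have : \forall n \near \oo, expR (- (n%:R : R)) < d.
  have /cvgrPdist_lt/(_ d d0) := @cvgn_expR R; apply: filterS => n.
  by rewrite sub0r normrN ger0_norm ?expR_ge0.
apply: filterS => n nd; apply: dU; apply: ball_sym.
rewrite ballEmdist /= -[mdist _ _]/(Defs.edist _ _) /Defs.edist subr0.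
exact: le_lt_trans (enorm_eps_pow _) nd.
Qed.

End EpsPow.

Section Modules.
Variables (R : realType) (M : topGModType R).

Lemma gscaler_continuous (c : Ctilde R) : continuous (fun x : M => c *: x).
Proof.
move=> x; apply: (@continuous2_cvg _ _ _ _ _ _ _ _
  (fun (c : Ctilde R) (x : M) => c *: x) c x (@gscale_continuous R M (c, x))).
  exact: cvg_cst.
exact: cvg_id.
Qed.

(** The scalars eps^n tend to 0, so eps^n x tends to 0 by continuity of the
    scalar multiplication. *)
Lemma nbhs0_absorbing (V : set M) (x : M) :
  nbhs 0 V -> exists n : nat, V (eps_pow (n%:R : R) *: x).
Proof.
move=> V0.
have : (fun n : nat => eps_pow (n%:R : R) *: x) @ \oo --> (0 : Ctilde R) *: x.
  apply: (@continuous2_cvg _ _ _ _ _ _ _ _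
    (fun (c : Ctilde R) (x : M) => c *: x) 0 x (@gscale_continuous R M (0, x))).
    exact: eps_pow_cvg0.
  exact: cvg_cst.
rewrite scale0r => h.
have /filter_ex[n Vn] : \forall n \near \oo, V (eps_pow (n%:R : R) *: x).
  exact: h.
by exists n.
Qed.

(** Convexity in this sense is stability under sums, so a symmetric convex set
    is a subgroup; intersecting with the opposite set makes it symmetric. *)
Lemma gconvex_subgroup (U : set M) : locally_gconvex M -> nbhs 0 U ->
  exists V : set M, [/\ nbhs 0 V, gconvex V,
    forall x y, V x -> V y -> V (x - y) & V `<=` U].
Proof.
move=> convM /convM[V [V0 [VD VZ] VU]].
exists (V `&` -%R @^-1` V); split.
- apply: filterI => //; apply: (@gopp_continuous R M 0).
  by rewrite oppr0.
- split; first by move=> x y [? ?] [? ?]; split=> /=; rewrite ?opprD; exact: VD.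
  by move=> b b0 x [? ?]; split=> /=; rewrite -?scalerN; exact: VZ.
- by move=> x y [? ?] [? ?]; split=> /=; rewrite ?opprB; [|rewrite addrC]; exact: VD.
- by move=> x [/VU].
Qed.

(** Multiplication by eps^b is a homeomorphism, with inverse eps^(-b). *)
Lemma eps_pow_image_thick (b : R) (A : set M) :
  thick A -> thick [set eps_pow b *: x | x in A].
Proof.
apply: (@thick_image _ _ _ (fun x : M => eps_pow (- b) *: x)).
- exact: gscaler_continuous.
- exact: gscaler_continuous.
- by move=> x; rewrite scalerA -eps_powD addNr eps_pow0 scale1r.
- by move=> x; rewrite scalerA -eps_powD addrN eps_pow0 scale1r.
Qed.

End Modules.

(** * Closed graph theorem *)

(** A nonmeager set covered by countably many sets meets one of them in a
    nonmeager set; this is applied at each level of the web in turn. *)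
Lemma web_nonmeager_branch (X : topologicalType) (F : Type) (f : X -> F)
    (C : seq nat -> set F) :
  is_web C -> ~ meager [set: X] ->
  exists n : nat -> nat, (forall k, (0 < n k)%N) /\
    (forall k, ~ meager (f @^-1` C (mkseq n k.+1))).
Proof.
move=> [C1 CS] nmX.
(* The web carries no information at the empty list, where the whole space
   serves as the root. *)
pose P s := if s is [::] then [set: X] else f @^-1` C s.
pose good s := all (fun n => 0 < n)%N s /\ ~ meager (P s).
have Prcons s n : P (rcons s n) = f @^-1` C (rcons s n) by case: s.
have step s : exists n, good s -> (0 < n)%N /\ good (rcons s n).
  have [[s0 nms]|ngs] := pselect (good s); last by exists 0%N.
  (* The admissible indices are positive, hence the shift to m.+1. *)
  have PE : P s = \bigcup_m P (rcons s m.+1).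
    have -> : P s = f @^-1` \bigcup_(n in [set n | (0 < n)%N]) C (rcons s n).
      by case: s s0 nms => [_ _|a s s0 _]; rewrite /= -?C1// -(CS (a :: s)).
    apply/seteqP; split=> x; first by move=> [[|m] //= _ Cm]; exists m; rewrite ?Prcons.
    by move=> [m _]; rewrite Prcons => Cm; exists m.+1.
  have [|m] := @nonmeager_pieces _ _ (fun m => P (rcons s m.+1)) nms.
    by rewrite -PE.
  rewrite setIidr => [nmm|]; last by rewrite PE => x Cx; exists m.
  by exists m.+1 => _; split=> //; split=> //; rewrite all_rcons.
have /choice[g gP] := step.
pose st := fix st k := if k is j.+1 then rcons (st j) (g (st j)) else [::].
have stP k : good (st k) by elim: k => //= k /gP[].
have stE k : st k = mkseq (g \o st) k by elim: k => //= k {1}->; rewrite mkseqS.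
exists (g \o st); split=> k; first exact: (gP _ (stP k)).1.
by have [_] := stP k.+1; rewrite [st k.+1]/= Prcons -[rcons _ _]/(st k.+1) stE.
Qed.

Theorem theorem1p8 (R : realType) (G F : topGModType R)
    (convG : locally_gconvex G) (baireG : baire_space G)
    (convF : locally_gconvex F) (webF : has_web_of_type_C F)
    (T : {linear G -> F}) (graphT : closed [set p : G * F | p.2 = T p.1]) :
  continuous T.
Proof.
suff T0 (U : set F) : nbhs 0 U -> nbhs (0 : G) (T @^-1` U).
  move=> x; have T00 : T @ (0 : G) --> (0 : F) by exact: T0.
  have -> : T = (fun y => T x + T (y - x)) :> (G -> F).
    by apply/funext => y; rewrite -raddfD addrC subrK.
  rewrite /continuous_at subrr raddf0; apply: cvgD_group; first exact: cvg_cst.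
  have : (fun y => y - x) @ x --> (0 : G).
    by rewrite -(subrr x); apply: cvgB_group; [exact: cvg_id | exact: cvg_cst].
  by move=> /cvg_comp; apply.
move=> /(gconvex_subgroup _ _ _ convF)[V [V0 [VD VZ] VB VU]].
apply: (@filterS _ _ _ (T @^-1` V)); first by move=> x /VU.
have [C [webC typeC]] := webF.
have nmG := @baire_nonmeager _ (0 : G) baireG.
have [n [n0 nmn]] := @web_nonmeager_branch _ _ T _ webC nmG.
have [rho rhoP] := typeC n n0.
have /choice[m nmm] : forall k, exists m, ~ meager
    (T @^-1` C (mkseq n k.+1) `&` [set x | V (eps_pow (m%:R : R) *: T x)]).
  move=> k; apply: (nonmeager_pieces _ _ _ (nmn k)) => x _.
  by have [m Vm] := nbhs0_absorbing _ _ _ (T x) V0; exists m.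
(* Exponents above rho k make the series converge, above m k they keep the
   images in V. *)
pose lambda k := Num.max (rho k) (m k)%:R.
pose D k := T @^-1` C (mkseq n k.+1) `&` [set x | V (eps_pow ((m k)%:R : R) *: T x)].
apply: (@closed_graph_thick G F T V
  (fun k => [set eps_pow (lambda k) *: x | x in D k])) => //.
- exact: subgroup_closed.
- by move=> k; apply: eps_pow_image_thick; apply: nonmeager_thick; exact: nmm.
- move=> k _ [x [_ Vx] <-].
  have -> : eps_pow (lambda k) =
      eps_pow (lambda k - (m k)%:R) * eps_pow ((m k)%:R : R).
    by rewrite -eps_powD subrK.
  rewrite /= linearZ_LR -scalerA; apply: VZ => //.
  by rewrite subr_ge0 le_max lexx orbT.
- move=> b Db.
  have /choice[d dP] : forall k, exists x, D k x /\ eps_pow (lambda k) *: x = b k.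
    by move=> k; have [x ? ?] := Db k; exists x.
  have -> : T \o b = (fun k => eps_pow (lambda k) *: T (d k)).
    by apply/funext => k; rewrite /= -(dP k).2 linearZ_LR.
  apply: rhoP => k; first by rewrite le_max lexx.
  exact: (dP k).1.1.
Qed.
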